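(* Let $\mathcal S$ be a subset of the positive integers and let $M$ be a positive integer. For each integer $n \geq 0$, let $p_{\mathcal S}^{(M)}(n)$ denote the number of ways to climb a staircase containing $n$ stairs using step-sizes in $\mathcal S$ and multiplicities at most $M$ (the order of the steps being irrelevant), that is, $$p_{\mathcal S}^{(M)}(n) = \# \left\{ (m_s)_{s \in \mathcal S} \ \middle|\ n = \sum_{s \in \mathcal S} m_s\, s \ \text{ and } \ 0 \leq m_s \leq M \text{ for all } s \in \mathcal S \right\}.$$ Then for every real number $x$ with $|x| < 1$, $$\sum_{n=0}^{\infty} p_{\mathcal S}^{(M)}(n)\, x^n = \prod_{s \in \mathcal S} \frac{1 - x^{(M+1)s}}{1 - x^s}.$$
   Context: The set $\mathcal S$ may be finite or infinite. The sequences $(m_s)_{s \in \mathcal S}$ being counted consist of nonnegative integers $m_s$, all but finitely many of which are zero; $m_s$ is the multiplicity with which the step-size $s$ is used. The convention $p_{\mathcal S}^{(M)}(0) = 1$ is used. *)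

(* Defs.v *)
From HB Require Import structures.
From mathcomp Require Import all_boot all_order all_algebra.
From mathcomp Require Import finmap.
From mathcomp Require Import all_classical all_reals all_analysis.

Set Implicit Arguments.
Unset Strict Implicit.
Unset Printing Implicit Defensive.

Import Order.TTheory GRing.Theory Num.Theory.
Import numFieldNormedType.Exports.

Local Open Scope classical_set_scope.
Local Open Scope ring_scope.

(* A sequence (m_s) indexed by the elements s of S and vanishing for all but
   finitely many s is a finitely supported function on the subtype S. *)
Definition climbs (S : set nat) (M n : nat) : set {fsfun S -> nat with 0%N} :=
  [set m | n = (\sum_(s <- finsupp m) m s * \val s)%N /\
           forall s : S, (0 <= m s <= M)%N].

Arguments climbs : clear implicits.

(* [fset_set] returns the empty set on infinite sets; this does not happen
   here, by [finite_climbs]. *)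
Definition num_climbs (S : set nat) (M n : nat) : nat :=
  #|` fset_set (climbs S M n) |.

(* The unordered infinite product over an index type I is the limit of the
   products over finite subsets of I, directed by inclusion. *)
Definition fsets_to_all (I : choiceType) : set_system {fset I} :=
  filter_from [set: {fset I}] (fun A => [set B | (A `<=` B)%fset]).

Global Instance fsets_to_all_proper (I : choiceType) :
  ProperFilter (@fsets_to_all I).
Proof.
apply: filter_from_proper; last by move=> A _; exists A => /=.
apply: filter_from_filter; first by exists fset0.
move=> A B _ _; exists (A `|` B)%fset => // C /=.
by rewrite fsubUset => /andP[].
Qed.

Definition partial_prod (R : realType) (I : choiceType) (f : I -> R)
  (A : {fset I}) : R := \prod_(i <- A) f i.

Definition infprod (R : realType) (I : choiceType) (f : I -> R) : R :=
  lim (partial_prod f @ @fsets_to_all I).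

Lemma finite_climbs (S : set nat) (M n : nat) :
  (forall s, S s -> (0 < s)%N) -> finite_set (climbs S M n).
Proof.
move=> S_gt0.
have bnd (m : {fsfun S -> nat with 0%N}) (s : S) :
    climbs S M n m -> m s != 0%N -> (m s <= n)%N /\ (\val s <= n)%N.
  move=> [nE _] ms0.
  have le : (m s * \val s <= n)%N.
    rewrite nE (big_fsetD1 s) ?mem_finsupp//=; exact: leq_addr.
  have s0 : (0 < \val s)%N by apply: S_gt0; apply/set_mem/(valP s).
  split; apply: leq_trans le; first exact: leq_pmulr.
  by apply: leq_pmull; rewrite lt0n.
pose code (m : {fsfun S -> nat with 0%N}) : {ffun 'I_n.+1 -> 'I_n.+1} :=
  [ffun i : 'I_n.+1 =>
     if insub (val i) is Some s then inord (m s) else ord0].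
have code_inj : {in climbs S M n &, injective code}.
  move=> m1 m2 /set_mem m1P /set_mem m2P /ffunP m12; apply/fsfunP => s.
  have codeE (m : {fsfun S -> nat with 0%N}) : climbs S M n m ->
      (\val s <= n)%N -> m s = code m (inord (\val s)).
    move=> mP sn; rewrite ffunE /= inordK// valK inordK//.
    have [->//|/(bnd _ _ mP)[]//] := eqVneq (m s) 0%N.
  have [sn|ns] := leqP (\val s) n; first by rewrite !codeE// m12.
  have out (m : {fsfun S -> nat with 0%N}) : climbs S M n m -> m s = 0%N.
    move=> mP; apply/eqP; apply: contraTT ns => /(bnd _ _ mP)[_ sn].
    by rewrite -leqNgt.
  by rewrite !out.
by rewrite -(eq_finite_set (inj_card_eq code_inj)).
Qed.

Lemma num_climbs0 (S : set nat) (M : nat) :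
  (forall s, S s -> (0 < s)%N) -> num_climbs S M 0 = 1%N.
Proof.
move=> S_gt0; rewrite /num_climbs.
suff -> : climbs S M 0 = [set [fsfun with 0%N]] by rewrite fset_set1 cardfs1.
apply/seteqP; split=> m /=; last first.
  move=> ->; split=> [|s]; last by rewrite fsfunE.
  by rewrite big1_fset// => s _ _; rewrite fsfunE.
move=> [/esym/eqP mE _]; apply/fsfunP => s; rewrite fsfunE.
move: mE; rewrite sum_nat_seq_eq0 => /allP ms0.
apply/eqP; have [sm|] := boolP (s \in finsupp m); last first.
  by rewrite memNfinsupp.
have /implyP/(_ isT) := ms0 s sm.
by rewrite muln_eq0 (gtn_eqF (S_gt0 _ (set_mem (valP s)))) orbF.
Qed.

(* Main.v *)
Require Import Defs.
From HB Require Import structures.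
From mathcomp Require Import all_boot all_order all_algebra.
From mathcomp Require Import finmap.
From mathcomp Require Import all_classical all_reals all_analysis.

Import Order.TTheory GRing.Theory Num.Theory.
Import numFieldNormedType.Exports.

Local Open Scope classical_set_scope.
Local Open Scope ring_scope.

(** Each factor is the finite geometric sum of the [x ^+ (j * s)], [j <= M], so
    the product over a finite set [B] of step-sizes expands into the generating
    polynomial of the climbs supported in [B]. Its [n]-th coefficient is at most
    [num_climbs S M n], with equality as soon as [B] contains all step-sizes up
    to [n]. For [r = `|x|] the bound [1 + M r^s <= expR (M r^s)] on the factors
    gives [expR (M / (1 - r))] as a bound on the partial sums of the series in
    [r], which therefore converges; when [B] contains all step-sizes below [N],
    the tail of that series from [N] on dominates the distance between the
    product over [B] and the [N]-th partial sum of the series in [x]. *)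

(** * Climbs with steps in a finite set *)

Definition weight {S : set nat} {M : nat} (B : {fset S})
    (g : {ffun B -> 'I_M.+1}) : nat :=
  (\sum_(s : B) g s * \val (\val s))%N.

Definition num_bounded_climbs {S : set nat} (M : nat) (B : {fset S})
    (n : nat) : nat :=
  #|[set g : {ffun B -> 'I_M.+1} | weight B g == n]%SET|.

(** Extension by zero outside [B]. For [s] in [B] the partial map [insub] succeeds, so the default
    [ord0] never contributes a value. *)
Definition fsfun_of_ffun {S : set nat} {M : nat} (B : {fset S})
    (g : {ffun B -> 'I_M.+1}) : {fsfun S -> nat with 0%N} :=
  [fsfun s in B => nat_of_ord (oapp g ord0 (insub s))].

Lemma fsfun_of_ffunE (S : set nat) (M : nat) (B : {fset S})
    (g : {ffun B -> 'I_M.+1}) (s : B) :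
  fsfun_of_ffun B g (\val s) = g s.
Proof. by rewrite fsfunE (valP s) valK. Qed.

Lemma sum_finsupp_sub (S : set nat) (B : {fset S})
    (m : {fsfun S -> nat with 0%N}) :
  (finsupp m `<=` B)%fset ->
  (\sum_(s <- finsupp m) m s * \val s = \sum_(s <- B) m s * \val s)%N.
Proof.
move=> mB; apply: big_fset_incl => // s _.
by rewrite memNfinsupp => /eqP ->.
Qed.

(** Extension by zero is injective and preserves the number of stairs. *)
Lemma num_bounded_climbs_le (S : set nat) (M : nat) (B : {fset S}) (n : nat) :
  (forall s, S s -> (0 < s)%N) ->
  (num_bounded_climbs M B n <= num_climbs S M n)%N.
Proof.
move=> S_gt0; rewrite /num_bounded_climbs cardE.
have inj : injective (fsfun_of_ffun (M := M) B).
  move=> g h gh; apply/ffunP => s; apply: val_inj => /=.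
  by rewrite -!fsfun_of_ffunE gh.
rewrite -(size_map (fsfun_of_ffun B)).
apply: uniq_leq_size; first by rewrite map_inj_uniq ?enum_uniq.
move=> _ /mapP[g + ->]; rewrite mem_enum inE => /eqP gn.
rewrite in_fset_set ?inE; last exact: finite_climbs.
split; last first.
  by move=> s; rewrite fsfunE; case: ifP => //= _; rewrite -ltnS ltn_ord.
rewrite (@sum_finsupp_sub _ B); last exact: finsupp_sub.
rewrite big_seq_fsetE /= -gn /weight.
by apply: eq_bigr => s _; rewrite fsfun_of_ffunE.
Qed.

(** A climb of [n] stairs uses only steps of size at most [n], all of which lie in [B]; hence it is
    determined by its restriction to [B]. *)
Lemma num_climbs_le (S : set nat) (M : nat) (B : {fset S}) (n : nat) :
  (forall s, S s -> (0 < s)%N) ->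
  (forall s : S, (\val s <= n)%N -> s \in B) ->
  (num_climbs S M n <= num_bounded_climbs M B n)%N.
Proof.
move=> S_gt0 B_small.
pose to_ffun (m : {fsfun S -> nat with 0%N}) : {ffun B -> 'I_M.+1} :=
  [ffun s => inord (m (\val s))].
have supp m : climbs S M n m -> (finsupp m `<=` B)%fset.
  move=> [nE _]; apply/fsubsetP => s sm; apply: B_small.
  rewrite nE (big_fsetD1 s) //=; apply: leq_trans (leq_addr _ _).
  by apply: leq_pmull; rewrite lt0n -mem_finsupp.
have to_ffunE m (s : B) : climbs S M n m -> to_ffun m s = m (\val s) :> nat.
  by move=> [_ /(_ (\val s)) mM]; rewrite ffunE inordK.
have inj : {in fset_set (climbs S M n) &, injective to_ffun}.
  move=> m1 m2; rewrite !in_fset_set ?inE; try exact: finite_climbs.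
  move=> m1P m2P /ffunP m12; apply/fsfunP => s.
  have [sB|sB] := boolP (s \in B).
    by rewrite -[s]/(\val (FSetSub sB)) -!to_ffunE // m12.
  have out m : climbs S M n m -> m s = 0%N.
    move=> /supp /fsubsetP mB; apply/eqP; rewrite -memNfinsupp.
    by apply: contra sB => /mB.
  by rewrite !out.
rewrite /num_bounded_climbs cardE /num_climbs cardfE cardE.
rewrite -(size_map (to_ffun \o \val)).
apply: uniq_leq_size.
  rewrite map_inj_in_uniq ?enum_uniq // => u v _ _ /= uv.
  by apply: val_inj; apply: inj uv; exact: valP.
move=> _ /mapP[u _ ->]; rewrite mem_enum inE /=.
have := valP u; rewrite in_fset_set ?inE => [uP|]; last exact: finite_climbs.
have [+ _] := uP; rewrite (@sum_finsupp_sub _ B); last exact: supp.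
rewrite big_seq_fsetE /= => nE; rewrite /weight [X in _ == X]nE.
by apply/eqP; apply: eq_bigr => s _; rewrite to_ffunE.
Qed.

(** * Expansion of finite products *)

Lemma partial_prod_geometric (R : realType) (S : set nat) (M : nat)
    (B : {fset S}) (x : R) :
  exists N0, forall N, (N0 <= N)%N ->
    partial_prod (fun s : S => \sum_(j < M.+1) x ^+ (j * \val s)) B =
    \sum_(0 <= n < N) (num_bounded_climbs M B n)%:R * x ^+ n.
Proof.
(* Only finitely many [g] exist; past the largest weight all coefficients vanish. *)
exists (\max_(g : {ffun B -> 'I_M.+1}) weight B g).+1 => N ltN.
have lt_weight (g : {ffun B -> 'I_M.+1}) : (weight B g < N)%N.
  by apply: leq_trans ltN; rewrite ltnS; exact: leq_bigmax.
rewrite /partial_prod big_seq_fsetE /= bigA_distr_bigA /=.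
rewrite (eq_bigr (fun g => x ^+ weight B g)); last first.
  by move=> g _; rewrite /weight expr_sum.
(* Monomials are grouped by exponent, each weight being an element of ['I_N]. *)
rewrite (partition_big (fun g => Ordinal (lt_weight g)) xpredT) //=.
rewrite big_mkord; apply: eq_bigr => n _.
rewrite (eq_bigr (fun=> x ^+ n)); last by move=> g /eqP <-.
rewrite sumr_const mulr_natl; congr (_ *+ _).
by apply: eq_card => g; rewrite !inE.
Qed.

Lemma sum_expr_fset_le (R : realType) (S : set nat) (B : {fset S}) (N : nat)
    (r : R) :
  (forall s, s \in B -> (\val s < N)%N) -> 0 <= r -> r < 1 ->
  \sum_(s <- B) r ^+ \val s <= (1 - r)^-1.
Proof.
move=> BN r0 r1.
have -> : \sum_(s <- B) r ^+ \val s = \sum_(n <- map \val B) r ^+ n.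
  by rewrite big_map.
(* Distinct steps give distinct exponents below [N], so the sum is a subsum of the geometric sum of
   length [N]. *)
have perm_B : perm_eq (map \val B) [seq n <- iota 0 N | n \in map \val B].
  apply: uniq_perm; first by rewrite map_inj_uniq ?fset_uniq //; exact: val_inj.
    by rewrite filter_uniq ?iota_uniq.
  move=> n; rewrite mem_filter mem_iota /= add0n.
  by case: mapP => //= -[s sB ->]; rewrite BN.
rewrite (perm_big _ perm_B) big_filter big_mkcond /=.
have le_geo : \sum_(n <- iota 0 N) (if n \in map \val B then r ^+ n else 0)
    <= \sum_(n < N) r ^+ n.
  rewrite -(big_mkord xpredT (fun n => r ^+ n)) /index_iota subn0.
  by apply: ler_sum => n _; case: ifP => // _; exact: exprn_ge0.
apply: le_trans le_geo _.
have r1' : 0 < 1 - r by rewrite subr_gt0.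
rewrite -[leRHS]mul1r ler_pdivlMr // mulrC.
rewrite -opprB mulNr -subrX1 opprB gerBl; exact: exprn_ge0.
Qed.

(** * Convergence of the generating series *)

Section generating_series.
Context (R : realType) (S : set nat) (M : nat).
Context (S_gt0 : forall s, S s -> (0 < s)%N).

(** The set is finite because [\val] is injective, so [fset_set] does not collapse it to the empty
    set. *)
Definition fset_below (N : nat) : {fset S} :=
  fset_set [set s : S | (\val s < N)%N].

Lemma in_fset_below (N : nat) (s : S) :
  (s \in fset_below N) = (\val s < N)%N.
Proof.
rewrite in_fset_set ?inE; last first.
  apply: (@finite_preimage _ _ `I_N (\val : S -> nat)); last exact: finite_II.
  by move=> ? ? _ _; exact: val_inj.
by apply/idP/idP => [/set_mem|] //; rewrite inE.
Qed.

Lemma num_bounded_climbsE (B : {fset S}) (n N : nat) :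
  (n < N)%N -> (fset_below N `<=` B)%fset ->
  num_bounded_climbs M B n = num_climbs S M n.
Proof.
move=> nN /fsubsetP NB; apply/eqP; rewrite eqn_leq num_bounded_climbs_le //=.
apply: num_climbs_le => // s sn; apply: NB.
by rewrite in_fset_below (leq_ltn_trans sn).
Qed.

Lemma partial_prod_geometric_le (r : R) (N : nat) : 0 <= r -> r < 1 ->
  partial_prod (fun s : S => \sum_(j < M.+1) r ^+ (j * \val s)) (fset_below N)
  <= expR (M%:R / (1 - r)).
Proof.
move=> r0 r1.
apply: (@le_trans _ _ (expR (\sum_(s <- fset_below N) M%:R * r ^+ \val s))).
  rewrite expR_sum; apply: ler_prod => s _; apply/andP; split.
    by apply: sumr_ge0 => j _; exact: exprn_ge0.
  apply: le_trans (expR_ge1Dx _).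
  (* The term [j = 0] is 1; each of the [M] others has exponent at least [s], hence is at most
     [r ^+ s]. *)
  rewrite big_ord_recl mul0n expr0 lerD2l.
  rewrite mulr_natl -[X in _ *+ X]card_ord -sumr_const.
  apply: ler_sum => j _; apply: ler_wiXn2l => //; first exact: ltW.
  exact: leq_pmull.
rewrite ler_expR -mulr_sumr ler_wpM2l //.
by apply: (@sum_expr_fset_le _ _ _ N) => // s; rewrite in_fset_below.
Qed.

Lemma is_cvg_series_num_climbs (r : R) : 0 <= r -> r < 1 ->
  cvgn (series (fun n => (num_climbs S M n)%:R * r ^+ n)).
Proof.
move=> r0 r1; apply: nondecreasing_is_cvgn.
  apply: nondecreasing_series => n _ _.
  by rewrite mulr_ge0 ?exprn_ge0.
exists (expR (M%:R / (1 - r))) => _ [N _ <-].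
apply: le_trans (partial_prod_geometric_le _ N r0 r1).
(* A length beyond both [N0] and [N] represents the whole product. Its first [N] terms are those of
   the series, and the rest are nonnegative. *)
have [N0 /(_ (maxn N0 N) (leq_maxl _ _)) ->] :=
  @partial_prod_geometric R S M (fset_below N) r.
rewrite /series /= [leRHS](big_cat_nat (n := N)) ?leq_maxr //=.
rewrite (eq_big_nat _ _
  (F2 := fun n => (num_bounded_climbs M (fset_below N) n)%:R * r ^+ n)).
  by rewrite lerDl; apply: sumr_ge0 => n _; rewrite mulr_ge0 ?exprn_ge0.
by move=> n /= nN; rewrite (@num_bounded_climbsE _ _ N).
Qed.

Lemma dist_partial_prod_series (x : R) (B : {fset S}) (N : nat) :
  `|x| < 1 -> (fset_below N `<=` B)%fset ->
  `|partial_prod (fun s : S => \sum_(j < M.+1) x ^+ (j * \val s)) B -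
    series (fun n => (num_climbs S M n)%:R * x ^+ n) N| <=
  limn (series (fun n => (num_climbs S M n)%:R * `|x| ^+ n)) -
  series (fun n => (num_climbs S M n)%:R * `|x| ^+ n) N.
Proof.
move=> x1 NB; set b := series (fun n => _ * `|x| ^+ n).
have [N0 /(_ (maxn N0 N) (leq_maxl _ _)) ->] :=
  @partial_prod_geometric R S M B x.
set N' := maxn N0 N; have NN' : (N <= N')%N := leq_maxr _ _.
have b_le : b N' <= limn b.
  apply: nondecreasing_cvgn_le; last exact: is_cvg_series_num_climbs.
  by apply: nondecreasing_series => n _ _; rewrite mulr_ge0 ?exprn_ge0.
(* With the limit replaced by the partial sum at [N'], both sides become sums from [N] to [N'],
   comparable term by term. *)
apply: le_trans (lerB b_le (lexx _)).
rewrite /b /series /= !(big_cat_nat (m := 0%N) (n := N) (p := N')) //=.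
rewrite [X in _ <= X]addrAC subrr add0r.
rewrite (eq_big_nat _ _
  (F2 := fun n => (num_climbs S M n)%:R * x ^+ n)); last first.
  by move=> n /= nN; rewrite (@num_bounded_climbsE _ _ N).
rewrite addrAC subrr add0r.
apply: le_trans (ler_norm_sum _ _ _) _; apply: ler_sum => n _.
rewrite normrM normrX normr_nat ler_wpM2r ?exprn_ge0 // ler_nat.
exact: num_bounded_climbs_le.
Qed.

End generating_series.

(** * Quotient form of the factors and passage to the limit *)

Lemma geometric_sum_quotient (R : realType) (x : R) (M s : nat) :
  `|x| < 1 -> (0 < s)%N ->
  (1 - x ^+ ((M + 1) * s)) / (1 - x ^+ s) = \sum_(j < M.+1) x ^+ (j * s).
Proof.
move=> x1 s0.
have xs : 1 - x ^+ s != 0.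
  rewrite subr_eq0; apply/eqP => /(congr1 Num.norm) /esym/eqP.
  by rewrite normr1 normrX lt_eqF // exprn_ilt1 // -lt0n.
apply: (canLR (mulfK xs)).
rewrite addn1 mulnC exprM -opprB subrX1 -mulNr opprB mulrC.
by congr (_ * _); apply: eq_bigr => j _; rewrite mulnC exprM.
Qed.

Theorem mainTheorem1 (R : realType) (S : set nat) (M : nat) (x : R)
  (S_gt0 : forall s, S s -> (0 < s)%N) (M_gt0 : (0 < M)%N)
  (x_lt1 : `|x| < 1) :
  let a := fun n : nat => (num_climbs S M n)%:R * x ^+ n : R in
  let f := fun s : S =>
    (1 - x ^+ ((M + 1) * \val s)) / (1 - x ^+ (\val s)) : R in
  [/\ cvg (series a @ \oo),
      cvg (partial_prod f @ @fsets_to_all S) &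
      lim (series a @ \oo) = infprod f].
Proof.
move=> a f.
pose b := series (fun n => (num_climbs S M n)%:R * `|x| ^+ n).
have cvg_b : cvgn b by exact: is_cvg_series_num_climbs.
have cvg_a : cvgn (series a).
  apply: normed_cvg; rewrite (_ : [normed series a] = b) //.
  apply/funext => N; rewrite /b /series /=.
  by apply: eq_bigr => n _; rewrite normrM normrX normr_nat.
have fE : f = fun s : S => \sum_(j < M.+1) x ^+ (j * \val s).
  apply/funext => s; apply: geometric_sum_quotient => //.
  exact: S_gt0 (set_mem (valP s)).
have prod_cvg : partial_prod f @ @fsets_to_all S --> limn (series a).
  apply/cvgrPdist_lt => e e0.
  have e2 : 0 < e / 2 by rewrite divr_gt0.
  have [N [aN bN]] : exists N, `|limn (series a) - series a N| < e / 2 /\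
      `|limn b - b N| < e / 2.
    have /cvgrPdist_lt/(_ _ e2) near_a := cvg_a.
    have /cvgrPdist_lt/(_ _ e2) near_b := cvg_b.
    have [N _ HN] := filterI near_a near_b.
    by exists N; exact: HN (leqnn N).
  (* For every finite [B] containing the steps below [N], the product is within [e / 2] of the
     [N]-th partial sum, itself within [e / 2] of the limit. *)
  exists (fset_below S N) => // B /= NB.
  rewrite (splitr e) distrC -[_ - _](subrKA (series a N)).
  apply: le_lt_trans (ler_normD _ _) _; rewrite addrC; apply: ltrD.
    by rewrite distrC.
  apply: le_lt_trans bN; apply: le_trans (ler_norm _).
  by rewrite fE; exact: dist_partial_prod_series.
split=> //; first by apply/cvg_ex; exists (limn (series a)).
by rewrite /infprod; apply/esym/cvg_lim.
Qed.
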